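(* For every constant $c>0$ there is a constant $C>0$ such that the following holds. Let $G$ be a connected weighted undirected graph with $n$ vertices and positive edge weights, and let $T$ be an inverse leverage score weighted random spanning tree of $G$. Then with probability at least $1-n^{-c}$, $$L_T\preceq C\log n\cdot L_G .$$
   Context: Let $G=(V,E,w)$ be a connected undirected graph with weights $w_e>0$. For an edge $e=(u,v)$ let $b_e\in\mathbb{R}^V$ have entry $1$ at $u$, $-1$ at $v$, and $0$ elsewhere. The Laplacian is $L_G=\sum_{e\in E}w_e b_eb_e^\top$, and $L_G^\dagger$ is its Moore-Penrose pseudoinverse. The leverage score of $e$ is $l_e=w_e\, b_e^\top L_G^\dagger b_e$. A random spanning tree $T$ of $G$ is sampled from the $w$-uniform distribution, in which the probability of a spanning tree $T$ is proportional to $\prod_{e\in T}w_e$. An inverse leverage score weighted random spanning tree is such a tree in which each edge $e\in T$ is given weight $w_e/l_e$, where $l_e$ is the leverage score of $e$ in $G$; thus its Laplacian is $L_T=\sum_{e\in T}\frac{w_e}{l_e}b_eb_e^\top$. $A\preceq B$ means that $B-A$ is positive semidefinite. *)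

(* Defs.v *)
From mathcomp Require Import all_boot all_order all_algebra.
From mathcomp Require Import all_classical all_reals all_analysis.

Set Implicit Arguments.
Unset Strict Implicit.
Unset Printing Implicit Defensive.

Import Order.TTheory GRing.Theory Num.Theory.
Local Open Scope ring_scope.

Definition loewner_le (R : realType) (n : nat) (A B : 'M[R]_n) : Prop :=
  (B - A)^T = B - A /\ forall x : 'cV[R]_n, 0 <= (x^T *m (B - A) *m x) 0 0.

Definition is_moore_penrose (R : realType) (m n : nat)
    (A : 'M[R]_(m, n)) (X : 'M[R]_(n, m)) : Prop :=
  [/\ A *m X *m A = A, X *m A *m X = X,
      (A *m X)^T = A *m X & (X *m A)^T = X *m A].

(* The default value of [xget] is never used, see [pinvP]; mathcomp's [pinvmx]
   is a different, only partial, inverse. *)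
Definition pinv (R : realType) (m n : nat) (A : 'M[R]_(m, n)) : 'M[R]_(n, m) :=
  xget 0 [set X | is_moore_penrose A X]%classic.

Lemma gram_unit (R : realType) (r n : nat) (F : 'M[R]_(r, n)) :
  row_free F -> F *m F^T \in unitmx.
Proof.
move=> Ff; rewrite -row_free_unit -kermx_eq0; apply/eqP/row_matrixP => i.
rewrite row0; apply/eqP; rewrite -(mulmx_free_eq0 _ Ff); apply/eqP.
set u := row i _.
have uF0 : (u *m F) *m (u *m F)^T = 0.
  rewrite trmx_mul mulmxA -(mulmxA u) (_ : u *m (F *m F^T) = 0) ?mul0mx //.
  by apply/sub_kermxP; apply: row_sub.
apply/rowP => j; rewrite mxE [RHS]mxE; apply/eqP; rewrite -sqrf_eq0.
have := congr1 (fun M : 'M[R]_1 => M 0 0) uF0; rewrite !mxE => /eqP.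
rewrite psumr_eq0 => [/allP/(_ j)|k _]; last by rewrite [_^T _ _]mxE -expr2 sqr_ge0.
by rewrite mem_index_enum => /(_ isT); rewrite [_^T _ _]mxE -expr2 !mxE.
Qed.

Lemma moore_penrose_exists (R : realType) (m n : nat) (A : 'M[R]_(m, n)) :
  exists X, is_moore_penrose A X.
Proof.
have := mulmx_base A; have := row_base_free A; have := col_base_full A.
move: (col_base A) (row_base A) => C F Cf Ff <-.
have uF := gram_unit Ff.
have uC : C^T *m C \in unitmx.
  rewrite -{2}[C]trmxK; apply: gram_unit.
  by rewrite /row_free mxrank_tr; move: Cf; rewrite /row_full.
pose X := F^T *m invmx (F *m F^T) *m (invmx (C^T *m C) *m C^T).
have CX : C *m F *m X = C *m invmx (C^T *m C) *m C^T.
  by rewrite /X !mulmxA -(mulmxA C F) -(mulmxA C (F *m _)) mulmxV // mulmx1.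
have XC : X *m (C *m F) = F^T *m invmx (F *m F^T) *m F.
  rewrite /X !mulmxA -(mulmxA _ C^T C) -(mulmxA _ (invmx (C^T *m C))).
  by rewrite mulVmx // mulmx1.
exists X; split.
- by rewrite CX !mulmxA -(mulmxA _ C^T C) -(mulmxA C (invmx _)) mulVmx // mulmx1.
- rewrite XC /X !mulmxA -(mulmxA _ F F^T) -(mulmxA _ (F *m F^T)) mulmxV //.
  by rewrite mulmx1.
- by rewrite CX !trmx_mul trmx_inv !trmx_mul !trmxK !mulmxA.
- by rewrite XC !trmx_mul trmx_inv !trmx_mul !trmxK !mulmxA.
Qed.

Lemma pinvP (R : realType) (m n : nat) (A : 'M[R]_(m, n)) :
  is_moore_penrose A (pinv A).
Proof.
rewrite /pinv; case: xgetP => // noX.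
by have [X /noX] := moore_penrose_exists A.
Qed.

Lemma moore_penrose_uniq (R : realType) (m n : nat) (A : 'M[R]_(m, n)) X Y :
  is_moore_penrose A X -> is_moore_penrose A Y -> X = Y.
Proof.
move=> [AXA XAX sAX sXA] [AYA YAY sAY sYA].
have eAX : A *m X = A *m Y.
  rewrite -[LHS]sAX -{1}AYA -(mulmxA _ A X) trmx_mul sAX sAY !mulmxA.
  by rewrite AXA.
have eXA : X *m A = Y *m A.
  by rewrite -[LHS]sXA -{1}AYA -(mulmxA A Y A) (mulmxA X) trmx_mul sXA sYA -mulmxA (mulmxA A) AXA.
by rewrite -XAX -mulmxA eAX mulmxA eXA YAY.
Qed.

Definition edge (n : nat) : finType := ('I_n * 'I_n)%type.

(* Finite simple graphs with positive edge weights: the undirected edge {u, v}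
   is the pair (u, v) with u < v. *)
Record wgraph (R : realType) (n : nat) := WGraph {
  edges : {set edge n};
  weight : edge n -> R;
  edges_lt : forall e, e \in edges -> (e.1 < e.2)%N;
  weight_gt0 : forall e, e \in edges -> 0 < weight e
}.

Definition adjacent (n : nat) (S : {set edge n}) : rel 'I_n :=
  fun u v => ((u, v) \in S) || ((v, u) \in S).

Definition connected_edges (n : nat) (S : {set edge n}) : Prop :=
  (0 < n)%N /\ forall u v : 'I_n, connect (adjacent S) u v.

(* [ucycle] counts single edges traversed back and forth as cycles of length 2. *)
Definition acyclic_edges (n : nat) (S : {set edge n}) : Prop :=
  forall p : seq 'I_n, ucycle (adjacent S) p -> (size p < 3)%N.

Definition connected_graph (R : realType) (n : nat) (G : wgraph R n) : Prop :=
  connected_edges (edges G).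

Definition spanning_tree (R : realType) (n : nat) (G : wgraph R n)
    (T : {set edge n}) : Prop :=
  [/\ T \subset edges G, connected_edges T & acyclic_edges T].

Definition bvec (R : realType) (n : nat) (e : edge n) : 'cV[R]_n :=
  \col_i ((i == e.1)%:R - (i == e.2)%:R).

Definition laplacian (R : realType) (n : nat) (S : {set edge n})
    (w : edge n -> R) : 'M[R]_n :=
  \sum_(e in S) w e *: (bvec R e *m (bvec R e)^T).

Definition graph_laplacian (R : realType) (n : nat) (G : wgraph R n) : 'M[R]_n :=
  laplacian (edges G) (weight G).

Definition leverage (R : realType) (n : nat) (G : wgraph R n) (e : edge n) : R :=
  weight G e * ((bvec R e)^T *m pinv (graph_laplacian G) *m bvec R e) 0 0.

Definition tree_laplacian (R : realType) (n : nat) (G : wgraph R n)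
    (T : {set edge n}) : 'M[R]_n :=
  laplacian T (fun e => weight G e / leverage G e).

Definition tree_mass (R : realType) (n : nat) (G : wgraph R n)
    (T : {set edge n}) : R :=
  \prod_(e in T) weight G e.

(* Probability of the event [A] for a w-uniform random spanning tree of [G]. *)
Definition tree_pr (R : realType) (n : nat) (G : wgraph R n)
    (A : {set edge n} -> Prop) : R :=
  (\sum_(T : {set edge n} | `[< spanning_tree G T /\ A T >]) tree_mass G T) /
  (\sum_(T : {set edge n} | `[< spanning_tree G T >]) tree_mass G T).

(* Main.v *)
Require Import Defs.
From mathcomp Require Import all_boot all_order all_algebra.
From mathcomp Require Import all_classical all_reals all_analysis.
From mathcomp Require Import ring lra.
(* Imported again because [functions] also defines a [pinv]. *)
Require Import Defs.
Set Implicit Arguments.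
Unset Strict Implicit.
Unset Printing Implicit Defensive.
Import Order.TTheory GRing.Theory Num.Theory.
Local Open Scope ring_scope.

(* Let B be the incidence matrix with rows sqrt(w_e) b_e^T and K = B L^+ B^T, an
   orthogonal projection of rank d = n - 1 whose diagonal entries are the leverage
   scores.  With u_e the normalised columns of K, the bound L_T <= q L_G becomes
   sum_(e in T) u_e u_e^T <= q on the range of B.  The w-uniform spanning tree is
   determinantal with kernel K: a d-tuple of edges has determinant
   det K_t = const * prod w_e if it lists a spanning tree, and 0 otherwise.
   Expanding det K_t by successive elimination turns the tree into a chain of d
   edges, the next edge being e with weight P_ee, where P is the projection K
   deflated by the edges already chosen.  Since P_ee <= K_ee and
   sum_e K_ee u_e u_e^T = K <= 1, when k edges are missing one step multiplies the
   total weight by k and the potential tr S^p, S = q + sum u u^T, by at most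
   k + 1, as soon as (1 + 1/q)^p <= 2.  Hence E tr S^p <= (d + 1) #edges q^p, while
   a violation of the bound forces tr S^p >= (2q)^p; take q = 2p with
   p of order log n and apply Markov. *)

(** * Moments of a positive matrix under a rank-one update *)

Definition bform (R : pzRingType) (m : nat) (A : 'M[R]_m) (x y : 'cV[R]_m) : R :=
  (x^T *m A *m y) 0 0.

Definition psd (R : realFieldType) (m : nat) (A : 'M[R]_m) : Prop :=
  A^T = A /\ forall x, 0 <= bform A x x.

Section Bform.
Variables (R : comPzRingType) (m : nat).
Implicit Types (A B : 'M[R]_m) (x y z : 'cV[R]_m).

Lemma bformDm A B x y : bform (A + B) x y = bform A x y + bform B x y.
Proof. by rewrite /bform mulmxDr mulmxDl mxE. Qed.

Lemma bformDl A x y z : bform A (x + y) z = bform A x z + bform A y z.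
Proof. by rewrite /bform linearD /= !mulmxDl mxE. Qed.

Lemma bformDr A x y z : bform A x (y + z) = bform A x y + bform A x z.
Proof. by rewrite /bform mulmxDr mxE. Qed.

Lemma bformZm a A x y : bform (a *: A) x y = a * bform A x y.
Proof. by rewrite /bform -scalemxAr -scalemxAl mxE. Qed.

Lemma bformZl a A x y : bform A (a *: x) y = a * bform A x y.
Proof. by rewrite /bform linearZ /= -!scalemxAl mxE. Qed.

Lemma bformZr a A x y : bform A x (a *: y) = a * bform A x y.
Proof. by rewrite /bform -scalemxAr mxE. Qed.

Lemma bform_tr A x y : bform A^T x y = bform A y x.
Proof. by rewrite /bform -[RHS]trace_mx11 -mxtrace_tr !trmx_mul trmxK mulmxA trace_mx11. Qed.

Lemma bform_mulr A B x y : bform (A *m B) x y = bform A x (B *m y).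
Proof. by rewrite /bform !mulmxA. Qed.

Lemma bform_mull A B x y : bform (A *m B) x y = bform B (A^T *m x) y.
Proof. by rewrite /bform trmx_mul trmxK !mulmxA. Qed.

Lemma bform_dyad A B x y u :
  bform (A *m (u *m u^T) *m B) x y = bform A x u * bform B u y.
Proof.
rewrite /bform !mulmxA -(mulmxA _ B y) -(mulmxA _ u^T) (mulmxA u^T).
by rewrite mxE big_ord1.
Qed.

Lemma mxtrace_dyad A u : \tr (A *m (u *m u^T)) = bform A u u.
Proof. by rewrite mulmxA mxtrace_mulC mulmxA trace_mx11. Qed.

Lemma bform_delta A i j : bform A (delta_mx i 0) (delta_mx j 0) = A i j.
Proof. by rewrite /bform trmx_delta -rowE -colE !mxE. Qed.

End Bform.

Section Psd.
Variables (R : realFieldType) (m : nat).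
Implicit Types (A B : 'M[R]_m) (x y z u : 'cV[R]_m).

Lemma bform1_ge0 x : 0 <= bform 1%:M x x.
Proof.
rewrite /bform mulmx1 mxE; apply: sumr_ge0 => i _.
by rewrite mxE -expr2 sqr_ge0.
Qed.

Lemma psd1 : psd (1%:M : 'M[R]_m).
Proof. by split; [rewrite trmx1 | exact: bform1_ge0]. Qed.

Lemma psdD A B : psd A -> psd B -> psd (A + B).
Proof.
move=> [sA pA] [sB pB]; split=> [|x]; first by rewrite linearD /= sA sB.
by rewrite bformDm addr_ge0.
Qed.

Lemma psd_dyad u : psd (u *m u^T).
Proof.
split=> [|x]; first by rewrite trmx_mul trmxK.
have := bform_dyad 1%:M 1%:M x x u; rewrite mul1mx mulmx1 => ->.
by rewrite -[X in _ * X]bform_tr trmx1 -expr2 sqr_ge0.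
Qed.

Lemma psd_CS A x y : psd A -> bform A x y ^+ 2 <= bform A x x * bform A y y.
Proof.
move=> [sA pA].
have q s t : 0 <= s ^+ 2 * bform A x x + 2 * (s * t * bform A x y)
                  + t ^+ 2 * bform A y y.
  have := pA (s *: x + t *: y).
  rewrite bformDl !bformDr !bformZl !bformZr -[in X in _ + (X + _)]sA bform_tr.
  by congr (_ <= _); ring.
have [y0|] := eqVneq (bform A y y) 0.
  (* With [bform A y y = 0], these values of [s] and [t] collapse the form to
     [- bform A x y ^+ 2]. *)
  have := q (bform A x y) (- (bform A x x + 1) / 2); rewrite y0 => h.
  nra.
have := pA y; rewrite le_eqVlt eq_sym => /orP[/eqP -> /eqP //|y_gt0 _].
rewrite -subr_ge0 -(pmulr_rge0 _ y_gt0).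
by have := q (bform A y y) (- bform A x y); congr (_ <= _); ring.
Qed.

Lemma mxXS A k : A ^+ k.+1 = A *m A ^+ k.
Proof. exact: exprS. Qed.

Lemma mxXSr A k : A ^+ k.+1 = A ^+ k *m A.
Proof. exact: exprSr. Qed.

Lemma trmxX A k : (A ^+ k)^T = A^T ^+ k.
Proof.
elim: k => [|k IH]; first by rewrite !expr0 trmx1.
by rewrite mxXS mxXSr trmx_mul IH.
Qed.

Lemma psdX A k : psd A -> psd (A ^+ k).
Proof.
move=> [sA pA]; split; first by rewrite trmxX sA.
(* Two consecutive powers are carried along, since [A ^+ k.+2] at [x] is [A ^+ k] at [A *m x]. *)
have [h1 h2] : (forall x, 0 <= bform (A ^+ k) x x) /\
   (forall x, 0 <= bform (A ^+ k.+1) x x); last by [].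
elim: k => [|k [IH1 IH2]].
  by split=> x; rewrite ?expr0 ?expr1 ?bform1_ge0.
by split=> // x; rewrite mxXS mxXSr bform_mull sA bform_mulr.
Qed.

Lemma psd_tr_ge0 A : psd A -> 0 <= \tr A.
Proof.
by move=> [_ pA]; apply: sumr_ge0 => i _; rewrite -bform_delta.
Qed.

End Psd.

Section LogConvex.
Variables (R : realFieldType) (a : nat -> R).
Hypothesis a_gt0 : forall k, 0 < a k.
Hypothesis a_lc : forall k, a k.+1 ^+ 2 <= a k * a k.+2.

(** Log-convexity makes the ratios [a k.+1 / a k] nondecreasing; this is that fact cleared of
    denominators. *)
Lemma logconvex_ratio i k : a i.+1 * a (i + k)%N <= a i * a (i + k).+1.
Proof.
elim: k => [|k IH]; first by rewrite addn0 mulrC.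
rewrite addnS -(ler_pM2r (a_gt0 (i + k))).
have := a_lc (i + k); have := a_gt0 i; have := a_gt0 (i + k).+1.
have := a_gt0 (i + k).
move: (a i) (a i.+1) (a (i + k)) (a (i + k).+1) (a (i + k).+2) IH.
by move=> x y z t w; nra.
Qed.

Lemma logconvex_supermul i j : a i * a j <= a 0%N * a (i + j)%N.
Proof.
elim: i => [|i IH]; first by rewrite add0n.
rewrite addSn -(ler_pM2r (a_gt0 i)) -(ler_pM2r (a_gt0 (i + j))).
have h := logconvex_ratio i j.
have e1 : a i.+1 * a j * a i * a (i + j) = (a i.+1 * a (i + j)) * (a i * a j) by ring.
have e2 : a 0%N * a (i + j).+1 * a i * a (i + j) =
  (a i * a (i + j).+1) * (a 0%N * a (i + j)) by ring.
by rewrite e1 e2; apply: ler_pM => //; rewrite mulr_ge0 // ltW.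
Qed.

End LogConvex.

Section Moments.
Variables (R : realFieldType) (m : nat) (S : 'M[R]_m) (u : 'cV[R]_m) (q : R).
Hypothesis q_gt0 : 0 < q.
Hypothesis S_psd : psd S.
Hypothesis S_ge : forall x, q * bform 1%:M x x <= bform S x x.
Hypothesis u1 : bform 1%:M u u = 1.

Local Notation mu k := (bform (S ^+ k) u u).

Lemma moment0 : mu 0 = 1. Proof. by rewrite expr0. Qed.

(** Cauchy-Schwarz for the form [S ^+ k] at the vectors [u] and [S *m u]. *)
Lemma moment_lc k : mu k.+1 ^+ 2 <= mu k * mu k.+2.
Proof.
have [sS _] := S_psd.
have := psd_CS u (S *m u) (psdX k S_psd).
rewrite -[X in _ <= _ * X](bform_mulr (S ^+ k)) -mxXSr.
have -> : bform (S ^+ k.+1) (S *m u) u = mu k.+2 by rewrite [S ^+ k.+2]mxXS bform_mull sS.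
by rewrite -bform_mulr -mxXSr.
Qed.

(** The ratio of consecutive moments is at least [q] at the start, since [u] is a unit vector, and
    log-convexity never lets it decrease. *)
Lemma moment_grows k : 0 < mu k /\ q * mu k <= mu k.+1.
Proof.
elim: k => [|k [k0 kS]]; first by rewrite expr0 expr1 u1 -u1 S_ge u1.
have kS0 : 0 < mu k.+1 by apply: lt_le_trans kS; rewrite mulr_gt0.
split=> //; rewrite -(ler_pM2l k0); apply: le_trans (moment_lc k).
by rewrite mulrA (mulrC _ q) expr2 ler_pM2r.
Qed.

Lemma moment_supermul i j : mu i * mu j <= mu (i + j).
Proof.
have := @logconvex_supermul R (fun k => mu k) (fun k => (moment_grows k).1) moment_lc i j.
by rewrite moment0 mul1r.
Qed.

Lemma moment1X k : mu 1 ^+ k <= mu k.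
Proof.
elim: k => [|k IH]; first by rewrite !expr0 u1.
apply: le_trans (moment_supermul 1 k); rewrite exprS ler_pM2l //.
by have [] := moment_grows 1.
Qed.

Local Notation nu k i := (bform (S ^+ i *m (S + 1%:M) ^+ k) u u).

Lemma nuS k i : nu k.+1 i = nu k i.+1 + nu k i.
Proof.
by rewrite mxXS mulmxA mulmxDr mulmx1 mulmxDl bformDm -mxXSr.
Qed.

Lemma nu_supermul k i j : nu k j * mu i <= nu k (i + j).
Proof.
elim: k j => [|k IH] j.
  by rewrite !expr0 !mulmx1 mulrC; apply: moment_supermul.
by rewrite !nuS mulrDl -addnS lerD.
Qed.

(* Each word in S and u u^T contributes a product of moments of S, so
   mu_i mu_j <= mu_(i+j) allows u u^T to be replaced by 1. *)
Lemma moment_dyad k i : bform (S ^+ i *m (S + u *m u^T) ^+ k) u u <= nu k i.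
Proof.
elim: k i => [|k IH] i; first by rewrite !expr0.
rewrite nuS mxXS mulmxA mulmxDr mulmxDl bformDm -[S ^+ i *m S]mxXSr.
rewrite lerD // bform_dyad mulrC -{2}(addn0 i).
apply: le_trans (nu_supermul k i 0); rewrite ler_wpM2r ?(ltW (moment_grows i).1) //.
by have := IH 0%N; rewrite !expr0 !mul1mx.
Qed.

(** The factors [S + u *m u^T] are removed one at a time: the [S] part lengthens the power on the
    right, and the dyad part becomes, by cyclicity, a quadratic form bounded by [moment_dyad]. *)
Lemma trace_dyad k i :
  \tr ((S + u *m u^T) ^+ k *m S ^+ i) <= \tr (S ^+ (k + i)) + (nu k i - mu (k + i)).
Proof.
elim: k i => [|k IH] i; first by rewrite !expr0 mulmx1 mul1mx subrr addr0.
rewrite mxXSr mulmxDr mulmxDl -mulmxA -[S *m _]mxXS linearD /=.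
have -> : \tr ((S + u *m u^T) ^+ k *m (u *m u^T) *m S ^+ i)
    = bform (S ^+ i *m (S + u *m u^T) ^+ k) u u.
  by rewrite mxtrace_mulC !mulmxA -(mulmxA _ u) mxtrace_dyad.
apply: le_trans (lerD (IH _) (moment_dyad k i)) _.
by rewrite nuS addSnnS; lra.
Qed.

Lemma nu_le k i : nu k i <= (1 + q^-1) ^+ k * mu (k + i).
Proof.
elim: k i => [|k IH] i; first by rewrite !expr0 mulmx1 mul1r.
rewrite nuS; apply: le_trans (lerD (IH _) (IH _)) _.
rewrite -mulrDr exprSr -mulrA ler_wpM2l ?exprn_ge0 ?addr_ge0 ?invr_ge0 ?(ltW q_gt0) //.
rewrite addnS addSn mulrDl mul1r lerD2l mulrC ler_pdivlMr // mulrC.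
exact: (moment_grows _).2.
Qed.

Lemma trace_dyad_le p : (1 + q^-1) ^+ p <= 2 ->
  \tr ((S + u *m u^T) ^+ p) <= \tr (S ^+ p) + mu p.
Proof.
move=> h; have := trace_dyad p 0; rewrite expr0 mulmx1 addn0 => /le_trans; apply.
rewrite lerD2l lerBlDr; apply: le_trans (nu_le p 0) _.
rewrite addn0 -mulr2n -mulr_natl ler_wpM2r //.
exact: ltW (moment_grows p).1.
Qed.

(** With [Q] the projection orthogonal to [u], the gap between the two sides is the trace of
    [Q *m S ^+ p *m Q]. *)
Lemma moment_le_trace p : mu p <= \tr (S ^+ p).
Proof.
have [sA pA] := psdX p S_psd.
set A := S ^+ p in sA pA *.
pose Q := 1%:M - u *m u^T.
have uu : u^T *m u = 1%:M.
  by rewrite [LHS]mx11_scalar; congr (_%:M); move: u1; rewrite /bform mulmx1.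
have QQ : Q *m Q = Q.
  rewrite /Q mulmxBl mul1mx mulmxBr mulmx1 [X in _ - _ - (_ - X)](_ : _ = u *m u^T).
    by rewrite subrr subr0.
  by rewrite -mulmxA (mulmxA u^T) uu mul1mx.
have sQ : Q^T = Q by rewrite /Q linearB /= trmx1 trmx_mul trmxK.
have : 0 <= \tr (Q *m A *m Q).
  apply: psd_tr_ge0; split=> [|x]; first by rewrite !trmx_mul sQ sA mulmxA.
  by rewrite bform_mulr bform_mull sQ.
rewrite mxtrace_mulC mulmxA QQ mxtrace_mulC /Q mulmxBr mulmx1 linearB /= mxtrace_dyad.
by rewrite subr_ge0.
Qed.

End Moments.

(** * Elimination of a projection and the trace potential *)

Lemma sum_tuple0 (R : nmodType) (I : finType) (F : seq I -> R) :
  \sum_(t : 0.-tuple I) F t = F [::].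
Proof.
rewrite (big_pred1 [tuple]) // => t; apply/esym/eqP/val_inj.
by case: t => -[].
Qed.

Lemma sum_tupleS (R : nmodType) (I : finType) k (F : seq I -> R) :
  \sum_(t : k.+1.-tuple I) F t = \sum_e \sum_(t : k.-tuple I) F (e :: t).
Proof.
rewrite pair_big /= (reindex (fun x : I * k.-tuple I => [tuple of x.1 :: x.2])) //=.
exists (fun t => (thead t, [tuple of behead t])) => [[e t] _|t _].
  by congr (_, _); apply: val_inj.
by rewrite [RHS]tuple_eta; apply: val_inj.
Qed.

Section Deflation.
Variables (R : rcfType) (m : nat).
Implicit Types (P K S : 'M[R]_m) (e f : 'I_m) (s : seq 'I_m).

Definition orthoproj P := P^T = P /\ P *m P = P.

(** Schur complement at the entry [(e, e)]: for an orthogonal projection, the projection onto the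
    part of its range orthogonal to [col e P]. If [P e e = 0], the convention [0^-1 = 0] leaves [P]
    unchanged. *)
Definition deflate P e : 'M[R]_m := P - (P e e)^-1 *: (col e P *m (col e P)^T).

(* [seq_det P s] is the principal minor of [P] indexed by [s], computed by
   successive elimination, see [seq_detE]. *)
Fixpoint seq_det P s : R :=
  if s is e :: s' then P e e * seq_det (deflate P e) s' else 1.

Lemma col_dot P e f : orthoproj P -> bform 1%:M (col e P) (col f P) = P e f.
Proof.
move=> [sP PP]; rewrite !colE -bform_mulr mul1mx.
by have := bform_mull P P (delta_mx e 0) (delta_mx f 0); rewrite sP PP bform_delta.
Qed.

Lemma orthoproj_diag_ge0 P e : orthoproj P -> 0 <= P e e.
Proof. by move=> oP; rewrite -(col_dot e e oP) bform1_ge0. Qed.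

Lemma orthoproj_diag0 P e f : orthoproj P -> P e e = 0 -> P e f = 0.
Proof.
move=> oP Pe0; have := psd_CS (col e P) (col f P) (psd1 R m).
rewrite !col_dot // Pe0 mul0r => h; apply/eqP.
by rewrite -sqrf_eq0 eq_le h sqr_ge0.
Qed.

Lemma orthoproj_mul_col P e : orthoproj P -> P *m col e P = col e P.
Proof. by move=> [_ PP]; rewrite !colE mulmxA PP. Qed.

Lemma deflate_orthoproj P e : orthoproj P -> orthoproj (deflate P e).
Proof.
move=> oP; have [Pe0|Pe0] := eqVneq (P e e) 0.
  by rewrite /deflate Pe0 invr0 scale0r subr0.
have [sP PP] := oP; split; first by rewrite /deflate linearB linearZ /= trmx_mul trmxK sP.
set v := col e P; have Pv : P *m v = v by apply: orthoproj_mul_col.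
have vP : v^T *m P = v^T by rewrite -{1}sP -trmx_mul Pv.
have vv : v^T *m v = (P e e)%:M.
  rewrite [LHS]mx11_scalar; congr (_%:M).
  by rewrite -(col_dot e e oP) /bform mulmx1.
rewrite /deflate -/v mulmxBl !mulmxBr PP -scalemxAr -scalemxAl !mulmxA Pv.
rewrite -mulmxA vP -scalemxAl -scalemxAr !scalerA -mulmxA (mulmxA v^T) vv.
by rewrite mul_scalar_mx -scalemxAr scalerA mulfVK // subrr subr0.
Qed.

Lemma deflate_tr P e : orthoproj P -> P e e != 0 -> \tr (deflate P e) = \tr P - 1.
Proof.
move=> oP Pe0; rewrite /deflate linearB /= linearZ /=; congr (_ - _).
have := mxtrace_dyad 1%:M (col e P); rewrite mul1mx => ->.
by rewrite col_dot // mulVf.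
Qed.

Lemma deflate_diag_le P e f : orthoproj P -> deflate P e f f <= P f f.
Proof.
move=> oP; rewrite /deflate !mxE big_ord1 !mxE gerBl mulr_ge0 ?invr_ge0 //.
  exact: orthoproj_diag_ge0.
by rewrite -expr2 sqr_ge0.
Qed.

Lemma seq_det_ge0 P s : orthoproj P -> 0 <= seq_det P s.
Proof.
elim: s P => [|e s IH] P oP //=.
by rewrite mulr_ge0 ?orthoproj_diag_ge0 ?IH //; apply: deflate_orthoproj.
Qed.

(** Each elimination lowers the trace by one, so the successive sums contribute [k], [k - 1], and so
    on down to 1. *)
Lemma sum_seq_det P k : orthoproj P -> \tr P = k%:R ->
  \sum_(t : k.-tuple 'I_m) seq_det P t = (k`!)%:R.
Proof.
elim: k P => [|k IH] P oP trP; first by rewrite sum_tuple0.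
rewrite (sum_tupleS k (seq_det P)) factS natrM -trP mulr_suml.
apply: eq_bigr => e _ /=; have [->|Pe0] := eqVneq (P e e) 0.
  by rewrite mul0r big1 // => t _; rewrite mul0r.
rewrite -mulr_sumr IH //; first exact: deflate_orthoproj.
by rewrite deflate_tr // trP -natr1 addrK.
Qed.

Definition unit_col K e : 'cV[R]_m := (Num.sqrt (K e e))^-1 *: col e K.

Definition frame K s : 'M[R]_m := \sum_(e <- s) unit_col K e *m (unit_col K e)^T.

Lemma frame_psd K s : psd (frame K s).
Proof.
rewrite /frame; elim/big_rec: _ => [|e A _ pA].
  split=> [|x]; first by rewrite trmx0.
  by rewrite -(scale0r 1%:M) bformZm mul0r.
by apply: psdD => //; apply: psd_dyad.
Qed.

Lemma unit_col1 K e : orthoproj K -> K e e != 0 ->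
  bform 1%:M (unit_col K e) (unit_col K e) = 1.
Proof.
move=> oK Ke0; rewrite bformZl bformZr col_dot // mulrA -invfM -expr2.
by rewrite sqr_sqrtr ?orthoproj_diag_ge0 // mulVf.
Qed.

(** The decomposition of [K] as the sum of [K e e] times the dyads of [unit_col K e], tested against
    [A]. *)
Lemma sum_unit_col K A : orthoproj K ->
  \sum_e K e e * bform A (unit_col K e) (unit_col K e) = \tr (K *m A *m K).
Proof.
move=> oK; have [sK _] := oK; apply: eq_bigr => e _.
have -> : (K *m A *m K) e e = bform A (col e K) (col e K).
  by rewrite -bform_delta bform_mulr bform_mull sK !colE.
have [Ke0|Ke0] := eqVneq (K e e) 0.
  suff -> : col e K = 0 by rewrite Ke0 mul0r /bform mulmx0 mxE.
  by apply/colP => f; rewrite !mxE -sK mxE orthoproj_diag0.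
rewrite bformZl bformZr (mulrA _^-1) -invfM -expr2 mulrA.
by rewrite sqr_sqrtr ?orthoproj_diag_ge0 // mulfV // mul1r.
Qed.

Lemma tr_compress_le K A : orthoproj K -> psd A -> \tr (K *m A *m K) <= \tr A.
Proof.
move=> [sK KK] [sA pA]; pose Q := 1%:M - K.
have sQ : Q^T = Q by rewrite /Q linearB /= trmx1 sK.
have QQ : Q *m Q = Q.
  by rewrite /Q mulmxBl mul1mx mulmxBr mulmx1 KK subrr subr0.
have : 0 <= \tr (Q *m A *m Q).
  apply: psd_tr_ge0; split=> [|x]; first by rewrite !trmx_mul sQ sA mulmxA.
  by rewrite bform_mulr bform_mull sQ.
rewrite mxtrace_mulC mulmxA QQ (mxtrace_mulC (K *m A)) mulmxA KK.
by rewrite /Q mulmxBl mul1mx linearB /= subr_ge0.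
Qed.

(** One step of the chain deflates [P] and adds a dyad to [S]; the hypotheses on [P] and [S] are
    those that survive such a step. The bound [P e e <= K e e] lets [sum_unit_col] control the added
    quadratic forms. *)
Lemma sum_seq_det_trace K (q : R) p k P S :
  orthoproj K -> 0 < q -> (1 + q^-1) ^+ p <= 2 ->
  orthoproj P -> \tr P = k%:R -> (forall e, P e e <= K e e) ->
  psd S -> (forall x, q * bform 1%:M x x <= bform S x x) ->
  \sum_(t : k.-tuple 'I_m) seq_det P t * \tr ((S + frame K t) ^+ p)
    <= (k.+1)`!%:R * \tr (S ^+ p).
Proof.
move=> oK q_gt0 hq; elim: k P S => [|k IH] P S oP trP lePK pS geS.
  rewrite (sum_tuple0 (fun t => seq_det P t * \tr ((S + frame K t) ^+ p))).
  by rewrite /frame big_nil addr0.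
rewrite (sum_tupleS k (fun t => seq_det P t * \tr ((S + frame K t) ^+ p))).
pose u := unit_col K; set T := \tr (S ^+ p).
have step e : \sum_(t : k.-tuple 'I_m)
      seq_det P (e :: t) * \tr ((S + frame K (e :: t)) ^+ p)
    <= (k.+1)`!%:R * (P e e * (T + bform (S ^+ p) (u e) (u e))).
  have [Pe0|Pe0] := eqVneq (P e e) 0.
    by rewrite big1 ?Pe0 ?mul0r ?mulr0 // => t _; rewrite /= Pe0 !mul0r.
  have Pe_gt0 : 0 < P e e by rewrite lt_def Pe0 orthoproj_diag_ge0.
  have Ke0 : K e e != 0 by rewrite gt_eqF // (lt_le_trans Pe_gt0).
  have uu := unit_col1 oK Ke0.
  under eq_bigr => t _ do rewrite /= -mulrA /frame big_cons addrA.
  rewrite -mulr_sumr mulrCA ler_pM2l //.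
  apply: le_trans (IH _ _ _ _ _ _ _) _.
  - exact: deflate_orthoproj.
  - by rewrite deflate_tr // trP -natr1 addrK.
  - by move=> f; apply: le_trans (lePK f); apply: deflate_diag_le.
  - by apply: psdD => //; apply: psd_dyad.
  - move=> x; rewrite bformDm; apply: le_trans (geS x) _.
    by rewrite lerDl (psd_dyad (u e)).2.
  by rewrite ler_wpM2l // (trace_dyad_le q_gt0).
apply: le_trans (ler_sum _ (fun e _ => step e)) _.
rewrite -mulr_sumr [(k.+2)`!]factS natrM [X in _ <= X * _]mulrC -mulrA ler_wpM2l //.
under eq_bigr => e _ do rewrite mulrDr.
(* The weights [P e e] have total [k.+1], so of [k.+2] copies of [T] one is left for the quadratic
   forms. *)
rewrite big_split /= -mulr_suml -/(\tr P) trP -[k.+2%:R]natr1 mulrDl mul1r lerD2l.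
have pSp := psdX p pS.
apply: le_trans (tr_compress_le oK pSp); rewrite -sum_unit_col //.
by apply: ler_sum => e _; rewrite ler_wpM2r //; apply: pSp.2.
Qed.

(** Markov's inequality for the chain started at [q%:M]: the initial trace is [q ^+ p * m%:R], a bad
    tuple ends with trace at least [(2 * q) ^+ p], and [q ^+ p] cancels. *)
Lemma sum_seq_det_tail K (q : R) p k (h : pred (k.-tuple 'I_m)) :
  orthoproj K -> \tr K = k%:R -> 0 < q -> (1 + q^-1) ^+ p <= 2 ->
  (forall t, h t -> exists x, q * bform 1%:M x x < bform (frame K t) x x) ->
  (\sum_(t | h t) seq_det K t) * 2 ^+ p <= k.+1`!%:R * m%:R.
Proof.
move=> oK trK q_gt0 hq bad.
have psdq : psd (q%:M : 'M[R]_m).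
  split=> [|x]; first by rewrite tr_scalar_mx.
  by rewrite -scalemx1 bformZm mulr_ge0 ?bform1_ge0 ?ltW.
have geq x : q * bform 1%:M x x <= bform (q%:M : 'M[R]_m) x x.
  by rewrite -(scalemx1 m q) bformZm.
have := sum_seq_det_trace oK q_gt0 hq oK trK (fun e => lexx _) psdq geq.
have -> : \tr ((q%:M : 'M[R]_m) ^+ p) = q ^+ p * m%:R.
  have -> : (q%:M : 'M[R]_m) ^+ p = (q ^+ p)%:M.
    elim: p {hq} => [|p IHp] //.
    by rewrite mxXS IHp -scalar_mxM exprS.
  by rewrite mxtrace_scalar mulr_natr.
rewrite mulrCA [X in _ <= X]mulrC => /(le_trans _) le_all.
rewrite -(ler_pM2r (exprn_gt0 p q_gt0)) -mulrA -exprMn; apply: le_all.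
rewrite mulr_suml big_mkcond /=; apply: ler_sum => t _.
have pS : psd (q%:M + frame K t).
  by apply: psdD => //; apply: frame_psd.
case: ifP => [/bad[y qy]|_]; last first.
  by rewrite mulr_ge0 ?seq_det_ge0 ?psd_tr_ge0 //; apply: psdX.
rewrite ler_wpM2l ?seq_det_ge0 //.
have geS z : q * bform 1%:M z z <= bform (q%:M + frame K t) z z.
  by apply: le_trans (geq z) _; rewrite bformDm lerDl (frame_psd K t).2.
have y0 : bform 1%:M y y != 0.
  apply: contraTneq qy => y0; rewrite y0 mulr0.
  suff -> : y = 0 by rewrite /bform mulmx0 mxE ltxx.
  apply/colP => i; have := psd_CS (delta_mx i 0) y (psd1 R m).
  rewrite y0 mulr0 /bform trmx_delta mulmx1 -rowE !mxE => yi.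
  by apply/eqP; rewrite -sqrf_eq0 eq_le yi sqr_ge0.
have y_gt0 : 0 < bform 1%:M y y by rewrite lt_def y0 bform1_ge0.
pose x := (Num.sqrt (bform 1%:M y y))^-1 *: y.
have normx A : bform A x x = (bform 1%:M y y)^-1 * bform A y y.
  by rewrite bformZl bformZr mulrA -invfM -expr2 sqr_sqrtr ?ltW.
have x1 : bform 1%:M x x = 1 by rewrite normx mulVf.
have qx : q <= bform (frame K t) x x.
  by rewrite normx mulrC ler_pdivlMr // ltW.
apply: le_trans (moment_le_trace pS x1 p).
apply: le_trans (moment1X q_gt0 pS geS x1 p).
rewrite lerXn2r ?nnegrE ?mulr_ge0 ?(ltW q_gt0) // expr1 ?pS.2 //.
by have := geq x; rewrite bformDm x1; lra.
Qed.

End Deflation.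

(** * Spanning trees and incidence determinants *)

Lemma det_schur (F : fieldType) k (a : F) (r : 'rV_k) (c : 'cV_k) (D : 'M[F]_k) :
  a != 0 ->
  \det (block_mx a%:M r c D) = a * \det (D - a^-1 *: (c *m r)).
Proof.
move=> a0; have -> : block_mx a%:M r c D =
   block_mx 1%:M 0 (a^-1 *: c) 1%:M *m block_mx a%:M r 0 (D - a^-1 *: (c *m r)).
  rewrite mulmx_block !mul1mx !mul0mx !addr0.
  congr block_mx; first by rewrite mul_mx_scalar scalerA mulfV // scale1r.
  by rewrite -scalemxAl addrC subrK.
by rewrite det_mulmx det_lblock det_ublock !det1 !mul1r det_scalar1.
Qed.

Lemma seq_detE (R : rcfType) m (P : 'M[R]_m) k (t : k.-tuple 'I_m) :
  orthoproj P ->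
  seq_det P t = \det (\matrix_(i, j) P (tnth t i) (tnth t j)).
Proof.
elim: k P t => [|k IH] P t oP; first by rewrite tuple0 det_mx00.
case/tupleP: t => e t /=.
set M := \matrix_(i, j) _.
have M0 i : M ord0 i = P e (tnth [tuple of e :: t] i) by rewrite mxE.
have [Pe0|Pe0] := eqVneq (P e e) 0.
  rewrite Pe0 mul0r (expand_det_row _ ord0) big1 // => i _.
  by rewrite M0 (orthoproj_diag0 _ oP Pe0) mul0r.
have -> : M = block_mx (P e e)%:M (\row_j P e (tnth t j)) (\col_i P (tnth t i) e)
     (\matrix_(i, j) P (tnth t i) (tnth t j)) :> 'M[R]_(1 + k).
  have tl (l : 'I_(1 + k)) (l' : 'I_1) : l = l' :> nat -> tnth [tuple of e :: t] l = e.
    by rewrite ord1 => h; rewrite (_ : l = ord0) ?tnth0 //; apply: val_inj.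
  have tr (l : 'I_(1 + k)) (l' : 'I_k) : l = (1 + l')%N :> nat ->
      tnth [tuple of e :: t] l = tnth t l'.
    by move=> h; rewrite (_ : l = lift ord0 l') ?tnthS //; apply: val_inj.
  apply/matrixP => i j; rewrite !mxE.
  case: splitP => i' ei; rewrite mxE; case: splitP => j' ej; rewrite !mxE.
  - by rewrite (tl _ _ ei) (tl _ _ ej) !ord1 mulr1n.
  - by rewrite (tl _ _ ei) (tr _ _ ej).
  - by rewrite (tr _ _ ei) (tl _ _ ej).
  - by rewrite (tr _ _ ei) (tr _ _ ej).
rewrite det_schur // IH; last exact: deflate_orthoproj.
congr (_ * \det _); apply/matrixP => i j; rewrite !mxE !big_ord1 !mxE.
by have -> : P (tnth t j) e = P e (tnth t j) by rewrite -{1}oP.1 mxE.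
Qed.


Section Incidence.
Variable d : nat.
Implicit Types (e : edge d.+1) (v : 'I_d.+1).

(** The vertex [ord0] is grounded, that is, its column is dropped, so that [d] edges give a square
    matrix. *)
Definition incidence (R : pzRingType) k (s : k.-tuple (edge d.+1)) : 'M[R]_(k, d) :=
  \matrix_(i, j) ((lift ord0 j == (tnth s i).1)%:R - (lift ord0 j == (tnth s i).2)%:R).

Lemma sum_potential (R : pzRingType) (x : 'I_d.+1 -> R) v :
  \sum_(j < d) (lift ord0 j == v)%:R * (x (lift ord0 j) - x ord0) = x v - x ord0.
Proof.
case: (unliftP ord0 v) => [i|] ->; last first.
  by rewrite subrr big1 // => j _; rewrite -(inj_eq val_inj) /= mul0r.
rewrite (bigD1 i) //= eqxx mul1r big1 ?addr0 // => j ji.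
by rewrite (inj_eq (@lift_inj _ ord0)) (negbTE ji) mul0r.
Qed.

Lemma incidence_potential (R : pzRingType) k (s : k.-tuple (edge d.+1)) (x : 'I_d.+1 -> R) i :
  (incidence R s *m \col_j (x (lift ord0 j) - x ord0)) i 0
    = x (tnth s i).1 - x (tnth s i).2.
Proof.
rewrite mxE; under eq_bigr => j _ do rewrite !mxE mulrBl.
by rewrite sumrB !sum_potential opprB addrA subrK.
Qed.

Lemma adjacent_sym (S : {set edge d.+1}) : symmetric (adjacent S).
Proof. by move=> u v; rewrite /adjacent orbC. Qed.

Lemma connect_adjacent_sym (S : {set edge d.+1}) : connect_sym (adjacent S).
Proof. exact/sym_connect_sym/adjacent_sym. Qed.

(** The integer row span contains [del ord0], which is zero, and then every [del v] by following a
    path edge by edge. Integrality later makes the square case unimodular. *)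
Lemma incidence_left_inverse k (s : k.-tuple (edge d.+1)) :
  connected_edges [set e in s] ->
  exists M : 'M[int]_(d, k), M *m incidence int s = 1%:M.
Proof.
move=> [_ conn]; set N := incidence int s.
pose del v : 'rV[int]_d := \row_j (lift ord0 j == v)%:R.
pose lat v := exists c : 'rV_k, c *m N = del v.
have rowN i : row i N = del (tnth s i).1 - del (tnth s i).2.
  by apply/rowP => j; rewrite !mxE.
have lat_adj u v : adjacent [set e in s] u v -> lat u -> lat v.
  rewrite /adjacent !inE => uv [c cN].
  case/orP: uv => /tnthP[i ei]; have := rowN i; rewrite -ei /= rowE => ri.
    by exists (c - delta_mx 0 i); rewrite mulmxBl cN ri opprB addrC subrK.
  by exists (c + delta_mx 0 i); rewrite mulmxDl cN ri addrC subrK.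
have lat0 : lat ord0.
  exists 0; rewrite mul0mx; apply/rowP => j.
  by rewrite !mxE -(inj_eq val_inj).
have latv v : lat v.
  have /connectP[p] := conn ord0 v; elim/last_ind: p v => [|p w IH] v /=.
    by move=> _ ->.
  rewrite rcons_path last_rcons => /andP[pp pw] ->.
  exact: lat_adj pw (IH _ pp erefl).
have [f fN] := fin_all_exists (fun i : 'I_d => latv (lift ord0 i)).
exists (\matrix_i f i); apply/row_matrixP => i.
rewrite row_mul rowK fN; apply/rowP => j; rewrite !mxE.
by rewrite (inj_eq (@lift_inj _ ord0)) eq_sym.
Qed.

Lemma connected_card (S : {set edge d.+1}) : connected_edges S -> (d <= #|S|)%N.
Proof.
move=> cS; have [M] : exists M : 'M[int]_(d, #|S|), M *m incidence int (enum_tuple S) = 1%:M.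
  apply: incidence_left_inverse; suff -> : [set e in enum_tuple S] = S by [].
  by apply/setP => e; rewrite inE mem_enum.
exact: mulmx1_min.
Qed.

Lemma det_incidence_connected (s : d.-tuple (edge d.+1)) :
  connected_edges [set e in s] -> \det (incidence int s) ^+ 2 = 1.
Proof.
move=> /incidence_left_inverse[M /(congr1 determinant)].
rewrite det_mulmx det1 => /(congr1 absz); rewrite abszM => /eqP.
rewrite muln_eq1 => /andP[_ /eqP h].
by move: (\det _) h => -[[|[|x]]|[|x]].
Qed.

(** The indicator of the component of [ord0] is a nonconstant potential with no difference along any
    edge, hence yields a nonzero kernel vector. *)
Lemma det_incidence_disconnected (s : d.-tuple (edge d.+1)) :
  ~ connected_edges [set e in s] -> \det (incidence int s) = 0.
Proof.
set A := [set e in s] => dis.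
pose x v : int := (connect (adjacent A) ord0 v)%:R.
have [v xv] : exists v, ~~ connect (adjacent A) ord0 v.
  apply/existsP; apply: contra_notT dis; rewrite negb_exists => /forallP h.
  split=> // u v; apply: (@connect_trans _ _ ord0).
    by rewrite connect_adjacent_sym; apply: negbNE.
  exact: negbNE.
apply/eqP; rewrite -det_tr; apply/det0P.
pose z : 'cV[int]_d := \col_j (x (lift ord0 j) - x ord0).
exists z^T; last first.
  rewrite -trmx_mul; apply/rowP => i; rewrite [RHS]mxE mxE incidence_potential.
  apply/eqP; rewrite subr_eq0; apply/eqP; congr (_%:R); congr (nat_of_bool _).
  apply: (same_connect_r (connect_adjacent_sym A)); apply: connect1.
  by rewrite /adjacent !inE -surjective_pairing mem_tnth.
case: (unliftP ord0 v) => [j|] ev; last by rewrite ev connect0 in xv.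
apply/eqP => /rowP /(_ j); rewrite !mxE /x -ev (negbTE xv) connect0.
by [].
Qed.

(** Deleting an edge of a forest separates its ends. The indicators of the components so obtained,
    read as potentials, form a right inverse of the incidence matrix, which bounds its number of
    rows. *)
Lemma acyclic_card (S : {set edge d.+1}) :
  (forall e, e \in S -> (e.1 < e.2)%N) -> acyclic_edges S -> (#|S| <= d)%N.
Proof.
move=> lt acy; pose s := enum_tuple S.
have sS i : tnth s i \in S by rewrite -mem_enum mem_tnth.
have s_inj : injective (tnth s) by apply/tuple_uniqP; apply: enum_uniq.
pose cut i := connect (adjacent (S :\ tnth s i)) (tnth s i).1.
have cut2 i : ~~ cut i (tnth s i).2.
  set e := tnth s i; have e12 := lt _ (sS i).
  apply/negP => /connectP[p0 pp0 lp0].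
  have {pp0 lp0}[p [pp up lp]] :
      exists p, [/\ path (adjacent (S :\ e)) e.1 p, uniq (e.1 :: p) & e.2 = last e.1 p].
    by move: lp0; case/shortenP: pp0 => p pp up _ lp; exists p.
  have : ucycle (adjacent S) (e.1 :: p).
    apply/andP; split=> //=; rewrite rcons_path -lp; apply/andP; split.
      apply: sub_path pp => u v; rewrite /adjacent !inE.
      by case/orP => /andP[_ ->] //; rewrite orbT.
    by rewrite /adjacent -surjective_pairing (sS i) orbT.
  (* The short cases: an empty path makes [e] a loop, and a single step uses the deleted edge or its
     reversal. The orientation of edges excludes the loop and the reversal. *)
  move/acy; case: p pp up lp => [|a [|//]] /= pp _ lp _.
    by rewrite -lp ltnn in e12.
  move: pp; rewrite -lp /adjacent !inE -surjective_pairing eqxx /= andbT.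
  by case/andP=> _ /lt /=; rewrite ltnNge ltnW.
pose X : 'M[int]_(d, #|S|) := \matrix_(j, i) ((cut i (lift ord0 j))%:R - (cut i ord0)%:R).
apply: (@mulmx1_min _ _ _ (incidence int s) X).
apply/matrixP => i j.
have -> : (incidence int s *m X) i j = (incidence int s *m col j X) i 0.
  by rewrite !mxE; apply: eq_bigr => l _; rewrite !mxE.
have -> : col j X = \col_l ((fun v => (cut j v)%:R) (lift ord0 l) - (cut j ord0)%:R).
  by apply/colP => l; rewrite !mxE.
rewrite (incidence_potential s (fun v => (cut j v)%:R)) [RHS]mxE; have [<-|ij] := eqVneq i j.
  by rewrite {1}/cut connect0 (negbTE (cut2 i)) subr0.
suff -> : cut j (tnth s i).1 = cut j (tnth s i).2 by rewrite subrr.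
apply: (same_connect_r (connect_adjacent_sym _)); apply: connect1.
by rewrite /adjacent !inE -surjective_pairing (inj_eq s_inj) ij (sS i).
Qed.

(** Deleting an edge of a cycle preserves connectivity but leaves fewer than [d] edges, against
    [connected_card]. *)
Lemma connected_acyclic (S : {set edge d.+1}) :
  connected_edges S -> #|S| = d -> acyclic_edges S.
Proof.
move=> [_ cS] dS p; rewrite ltnNge; apply: contraTN.
case: p => [|x [|y [|z q]]] // _; apply/negP => /andP[].
rewrite /= !inE !negb_or => /and3P[xy yz zx].
move=> /andP[/and3P[xNy xNz xq] /andP[/andP[yNz yq] _]].
pose S' := S :\ (x, y) :\ (y, x).
have sS' u v : adjacent S u v -> (u, v) != (x, y) -> (u, v) != (y, x) -> adjacent S' u v.
  rewrite /adjacent !inE !xpair_eqE.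
  move=> uv /negbTE h1 /negbTE h2.
  by rewrite h1 h2 (andbC (v == y)) h1 (andbC (v == x)) h2.
have yx : connect (adjacent S') y x.
  apply: (@connect_trans _ _ z).
    by apply: connect1; apply: sS' => //; rewrite xpair_eqE negb_and (eq_sym z) ?xNz ?yNz orbT.
  (* The rest of the cycle avoids [x] and [y] until its last step into [x], so it never uses the
     deleted edge. *)
  have zq_x w r : w != x -> w != y -> x \notin r -> y \notin r ->
      path (adjacent S) w (rcons r x) -> connect (adjacent S') w x.
    elim: r w => [|w' r IH] w wx wy /=; rewrite ?inE ?negb_or.
      move=> _ _ /andP[ww _]; apply/connect1/sS' => //.
        by rewrite xpair_eqE (negbTE wx).
      by rewrite xpair_eqE (negbTE wy).
    move=> /andP[xw' xr] /andP[yw' yr] /andP[ww' pr].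
    apply: (@connect_trans _ _ w'); last by apply: IH; rewrite // eq_sym.
    apply/connect1/sS' => //; first by rewrite xpair_eqE (negbTE wx).
    by rewrite xpair_eqE (negbTE wy).
  by apply: zq_x zx; rewrite // eq_sym.
have cS' : connected_edges S'.
  split=> // u v; apply: connect_sub (cS u v) => a b ab.
  have [[-> ->]|h1] := eqVneq (a, b) (x, y); first by rewrite connect_adjacent_sym.
  have [[-> ->]//|h2] := eqVneq (a, b) (y, x).
  exact/connect1/sS'.
suff : (#|S'| < d)%N by rewrite ltnNge connected_card.
rewrite -[X in (_ < X)%N]dS.
apply: proper_card; apply/properP; split.
  by apply/fintype.subsetP => e; rewrite !inE => /and3P[].
have /orP[h|h] := xy; [exists (x, y)|exists (y, x)] => //; rewrite !inE eqxx ?andbF //.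
Qed.

End Incidence.

(** * The transfer projection of a weighted graph *)

Lemma pinv_sym (R : realType) n (A : 'M[R]_n) : A^T = A -> (pinv A)^T = pinv A.
Proof.
move=> sA; apply: (moore_penrose_uniq (A := A)); last exact: pinvP.
have [AXA XAX sAX sXA] := pinvP A.
have e1 : A *m (pinv A)^T = pinv A *m A by rewrite -sXA trmx_mul sA.
have e2 : (pinv A)^T *m A = A *m pinv A by rewrite -sAX trmx_mul sA.
split.
- by have := congr1 trmx AXA; rewrite !trmx_mul sA mulmxA.
- by have := congr1 trmx XAX; rewrite !trmx_mul sA mulmxA.
- by rewrite e1.
- by rewrite e2.
Qed.

Lemma tr_mul_eq0 (R : realFieldType) m n (A : 'M[R]_(m, n)) : A^T *m A = 0 -> A = 0.
Proof.
move=> AA; apply/matrixP => i j; rewrite [RHS]mxE; apply/eqP; rewrite -sqrf_eq0.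
have := congr1 (fun M : 'M[R]_n => M j j) AA; rewrite !mxE => /eqP.
rewrite psumr_eq0 => [/allP/(_ i)|k _]; last by rewrite mxE -expr2 sqr_ge0.
by rewrite mem_index_enum mxE -expr2 => /(_ isT).
Qed.

Lemma spanning_treeE (R : realType) d (G : wgraph R d.+1) (T : {set edge d.+1}) :
  spanning_tree G T <-> [/\ T \subset edges G, connected_edges T & #|T| = d].
Proof.
split=> [[sT cT aT]|[sT cT dT]]; last by split=> //; apply: connected_acyclic.
split=> //; apply/eqP; rewrite eqn_leq connected_card // andbT.
by apply: acyclic_card aT => e /(fintype.subsetP sT); apply: edges_lt.
Qed.

Section Graph.
Variables (R : realType) (d : nat) (G : wgraph R d.+1).
Hypothesis G_conn : connected_graph G.

Local Notation m := #|{: edge d.+1}|.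
Local Notation ei := (@enum_val (edge d.+1) {: edge d.+1}).
Local Notation L := (graph_laplacian G).

(** Extension by zero lets the matrices be indexed by all vertex pairs; non-edges become zero rows
    of [wincidence]. *)
Definition ext_weight e : R := if e \in edges G then weight G e else 0.

Definition wincidence : 'M[R]_(m, d.+1) :=
  \matrix_(i, v) (Num.sqrt (ext_weight (ei i)) * bvec R (ei i) v 0).

(** The transfer-current matrix of the network. *)
Definition transfer : 'M[R]_m := wincidence *m pinv L *m wincidence^T.

Local Notation B := wincidence.
Local Notation K := transfer.

Lemma ext_weight_ge0 e : 0 <= ext_weight e.
Proof. by rewrite /ext_weight; case: ifP => // /weight_gt0/ltW. Qed.

Lemma row_wincidence i : row i B = Num.sqrt (ext_weight (ei i)) *: (bvec R (ei i))^T.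
Proof. by apply/rowP => v; rewrite !mxE. Qed.

Lemma sum_edges (F : edge d.+1 -> R) :
  \sum_(e in edges G) weight G e * F e = \sum_(i < m) ext_weight (ei i) * F (ei i).
Proof.
rewrite -(big_enum_val (fun e => ext_weight e * F e)) /= big_mkcond /=.
by apply: eq_bigr => e _; rewrite /ext_weight; case: ifP => // _; rewrite mul0r.
Qed.

Lemma laplacianE : L = B^T *m B.
Proof.
apply/matrixP => u v; rewrite summxE.
under eq_bigr => e _ do rewrite mxE.
rewrite (sum_edges (fun e => (bvec R e *m (bvec R e)^T) u v)) mxE.
apply: eq_bigr => i _; rewrite !mxE big_ord1 !mxE.
rewrite -{1}(sqr_sqrtr (ext_weight_ge0 (ei i))); ring.
Qed.

Lemma laplacian_sym : L^T = L.
Proof. by rewrite laplacianE trmx_mul trmxK. Qed.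

(** The difference [D] of the two sides satisfies [D^T *m D = 0], because [B^T *m B = L] and
    [L *m pinv L *m L = L]. *)
Lemma wincidence_pinv : B *m pinv L *m L = B.
Proof.
have [LXL _ _ sXL] := pinvP L.
apply/eqP; rewrite -subr_eq0; apply/eqP; apply: tr_mul_eq0.
rewrite -mulmxA -[X in _ - X]mulmx1 -mulmxBr trmx_mul -mulmxA (mulmxA B^T) -laplacianE.
by rewrite mulmxBr mulmx1 mulmxA LXL subrr mulmx0.
Qed.

Lemma transfer_orthoproj : orthoproj K.
Proof.
split; first by rewrite /transfer !trmx_mul trmxK (pinv_sym laplacian_sym) mulmxA.
rewrite /transfer !mulmxA -(mulmxA _ B^T) -laplacianE wincidence_pinv //.
Qed.

Lemma transfer_potential (x : 'cV[R]_d.+1) : K *m (B *m x) = B *m x.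
Proof. by rewrite /transfer !mulmxA -(mulmxA _ B^T) -laplacianE wincidence_pinv. Qed.

Lemma bvec_mul e (x : 'cV[R]_d.+1) : ((bvec R e)^T *m x) 0 0 = x e.1 0 - x e.2 0.
Proof.
rewrite mxE; under eq_bigr => v _ do rewrite !mxE mulrBl !mulr_natl !mulrb.
by rewrite sumrB -!big_mkcond !big_pred1_eq.
Qed.

Lemma wincidence_mul (x : 'cV[R]_d.+1) i :
  (B *m x) i 0 = Num.sqrt (ext_weight (ei i)) * ((bvec R (ei i))^T *m x) 0 0.
Proof.
have -> : (B *m x) i 0 = (row i B *m x) 0 0 by rewrite -row_mul [RHS]mxE.
by rewrite row_wincidence -scalemxAl mxE.
Qed.

Lemma wincidence_ker (x : 'cV[R]_d.+1) u v : B *m x = 0 -> x u 0 = x v 0.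
Proof.
move=> Bx; have [_ /(_ u v)/connectP[p]] := G_conn.
have adj a b : (a, b) \in edges G -> x a 0 = x b 0.
  move=> ab; have := wincidence_mul x (enum_rank (a, b)).
  rewrite Bx enum_rankK /ext_weight ab bvec_mul mxE => /esym/eqP.
  rewrite mulf_eq0 gt_eqF ?sqrtr_gt0 ?weight_gt0 //= subr_eq0.
  by move/eqP.
elim: p u => [|w p IH] u /=; first by move=> _ ->.
case/andP=> uw pp lp; rewrite -(IH w) //.
by case/orP: uw => /adj.
Qed.

(** By cyclicity this is the trace of [L *m pinv L], whose complement [P] projects onto the constant
    vectors because the graph is connected. *)
Lemma transfer_tr : \tr K = d%:R.
Proof.
have [LXL _ sLX _] := pinvP L.
rewrite /transfer mxtrace_mulC mulmxA -laplacianE.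
set P := 1%:M - L *m pinv L.
have sP : P^T = P by rewrite /P linearB /= trmx1 sLX.
have PL : P *m L = 0 by rewrite /P mulmxBl mul1mx LXL subrr.
have BP : B *m P = 0.
  by apply: tr_mul_eq0; rewrite trmx_mul -mulmxA (mulmxA B^T) -laplacianE sP mulmxA PL mul0mx.
have Pc u v w : P u w = P v w.
  have := @wincidence_ker (col w P) u v; rewrite !mxE; apply.
  by rewrite colE mulmxA BP mul0mx.
have oneL : (const_mx 1 : 'rV_d.+1) *m L = 0.
  rewrite laplacianE mulmxA; suff -> : (const_mx 1 : 'rV_d.+1) *m B^T = 0 by rewrite mul0mx.
  apply/trmx_inj; rewrite trmx_mul trmxK trmx_const trmx0.
  by apply/colP => i; rewrite wincidence_mul bvec_mul !mxE subrr mulr0.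
(* All entries of [P] agree, so its trace is a column sum, and that is 1 by [oneL]. *)
have trP : \tr P = 1.
  transitivity (((const_mx 1 : 'rV_d.+1) *m P) 0 0).
    rewrite mxE; apply: eq_bigr => u _; rewrite [const_mx _ _ _]mxE mul1r.
    rewrite (Pc u ord0 u); rewrite -[in LHS]sP [LHS]mxE; exact: Pc.
  by rewrite /P mulmxBr mulmx1 mulmxA oneL mul0mx subr0 mxE.
move: trP; rewrite /P linearB /= mxtrace1 -natr1 => trP; lra.
Qed.

Lemma transfer_diag i : K i i = ext_weight (ei i) *
  ((bvec R (ei i))^T *m pinv L *m bvec R (ei i)) 0 0.
Proof.
rewrite -bform_delta /transfer /bform !mulmxA trmx_delta -rowE row_wincidence.
rewrite -mulmxA -{1}(trmxK (delta_mx i 0)) -trmx_mul trmx_delta -rowE row_wincidence.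
rewrite linearZ /= trmxK -!scalemxAl -scalemxAr scalerA mxE -expr2.
by rewrite sqr_sqrtr ?ext_weight_ge0.
Qed.

Lemma tree_laplacian_form T (x : 'cV[R]_d.+1) :
  bform (tree_laplacian G T) x x =
  \sum_(e in T) weight G e / leverage G e * ((bvec R e)^T *m x) 0 0 ^+ 2.
Proof.
rewrite /bform /tree_laplacian /laplacian mulmx_sumr mulmx_suml summxE.
apply: eq_bigr => e _; rewrite -scalemxAr -scalemxAl mxE; congr (_ * _).
have := bform_dyad 1%:M 1%:M x x (bvec R e); rewrite /bform mul1mx !mulmx1 => ->.
rewrite expr2; congr (_ * _).
by rewrite -trace_mx11 -mxtrace_tr trmx_mul trmxK trace_mx11.
Qed.

(** Since [B *m x] lies in the range of [K], its inner product with column [i] of [K] is its [i]-th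
    coordinate. *)
Lemma frame_form t (x : 'cV[R]_d.+1) :
  bform (frame K t) (B *m x) (B *m x) =
  \sum_(i <- t) ext_weight (ei i) / K i i * ((bvec R (ei i))^T *m x) 0 0 ^+ 2.
Proof.
have oK := transfer_orthoproj.
rewrite /frame; elim: t => [|i t IH].
  by rewrite !big_nil -(scale0r 1%:M) bformZm mul0r.
rewrite !big_cons bformDm IH; congr (_ + _).
have := bform_dyad 1%:M 1%:M (B *m x) (B *m x) (unit_col K i).
rewrite mul1mx mulmx1 => ->; rewrite -[X in _ * X]bform_tr trmx1 -expr2.
have -> : bform 1%:M (B *m x) (unit_col K i) = (Num.sqrt (K i i))^-1 * (B *m x) i 0.
  rewrite bformZr -bform_tr trmx1; congr (_ * _).
  rewrite -{2}transfer_potential colE /bform mulmx1 trmx_mul oK.1 trmx_delta.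
  by rewrite -mulmxA -rowE mxE.
rewrite wincidence_mul !exprMn exprVn !sqr_sqrtr ?ext_weight_ge0 ?orthoproj_diag_ge0 //.
ring.
Qed.



(** Through this matrix every [bvec] factors, with a row of [incidence] as coefficients. *)
Definition grounding : 'M[R]_(d, d.+1) :=
  \matrix_(j, v) ((lift ord0 j == v)%:R - (ord0 == v)%:R).

(** The factor common to all tree minors; by [forest_const_sum] it is the inverse of the total tree
    mass. *)
Definition forest_const : R := \det (grounding *m pinv L *m grounding^T).

Lemma incidence_grounding k (s : k.-tuple (edge d.+1)) a v :
  (incidence R s *m grounding) a v = bvec R (tnth s a) v 0.
Proof.
have -> : (incidence R s *m grounding) a v
    = (incidence R s *m \col_j ((fun u => (u == v)%:R) (lift ord0 j) - (ord0 == v)%:R)) a 0.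
  by rewrite !mxE; apply: eq_bigr => j _; rewrite !mxE.
by rewrite (incidence_potential s (fun u => (u == v)%:R)) mxE ![v == _]eq_sym.
Qed.

(** The block of [K] on [t] is a product of square matrices of size [d]: diagonal, incidence and
    grounded Gram. The incidence determinant stays over [int], where it is 0 or a unit. *)
Lemma transfer_minor (t : d.-tuple 'I_m) :
  seq_det K t = (\prod_(e <- map_tuple ei t) ext_weight e)
    * (\det (incidence int (map_tuple ei t)) ^+ 2)%:~R * forest_const.
Proof.
rewrite (seq_detE t transfer_orthoproj).
set s := map_tuple ei t.
pose D := diag_mx (\row_a Num.sqrt (ext_weight (tnth s a))).
have -> : \matrix_(a, b) K (tnth t a) (tnth t b)
   = D *m (incidence R s *m (grounding *m pinv L *m grounding^T) *m (incidence R s)^T) *m D.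
  have eB : \matrix_(a, v) B (tnth t a) v = D *m (incidence R s *m grounding).
    apply/matrixP => a v; rewrite mul_diag_mx [RHS]mxE incidence_grounding.
    by rewrite !mxE tnth_map.
  rewrite -[X in _ = _ *m X](tr_diag_mx (\row_a Num.sqrt (ext_weight (tnth s a)))) -/D.
  have -> : D *m (incidence R s *m (grounding *m pinv L *m grounding^T) *m (incidence R s)^T) *m D^T
     = \matrix_(a, v) B (tnth t a) v *m pinv L *m (\matrix_(a, v) B (tnth t a) v)^T.
    by rewrite eB !trmx_mul !mulmxA.
  apply/matrixP => a b; rewrite mxE /transfer !mxE; apply: eq_bigr => v _.
  by rewrite !mxE; congr (_ * _); apply: eq_bigr => u _; rewrite !mxE.
have -> : incidence R s = map_mx intr (incidence int s).
  by apply/matrixP => a j; rewrite !mxE rmorphB /= !mulrz_nat.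
rewrite !det_mulmx det_tr det_map_mx det_diag rmorphXn /=.
have -> : \prod_(e <- s) ext_weight e = (\prod_a Num.sqrt (ext_weight (tnth s a))) ^+ 2.
  rewrite big_tuple -prodrXl; apply: eq_bigr => a _.
  by rewrite sqr_sqrtr ?ext_weight_ge0.
rewrite -/forest_const; under eq_bigr => a _ do rewrite mxE.
ring.
Qed.

Definition tuple_edges (t : d.-tuple 'I_m) : {set edge d.+1} := [set e in map_tuple ei t].

Lemma uniq_tuple_edges (t : d.-tuple 'I_m) : #|tuple_edges t| = d -> uniq t.
Proof.
rewrite /tuple_edges cardsE => ct; rewrite -(map_inj_uniq enum_val_inj).
by apply/card_uniqP; rewrite ct size_map size_tuple.
Qed.

Lemma card_tuple_edges (T : {set edge d.+1}) : #|T| = d ->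
  #|[pred t : d.-tuple 'I_m | tuple_edges t == T]| = d`!.
Proof.
move=> cT; pose A := [pred i | ei i \in T].
have cA : #|A| = d.
  rewrite -[RHS]cT -(fintype.card_image (@enum_val_inj _ _) A); apply: eq_card => e.
  apply/fintype.imageP/idP => [[i iT ->] //|eT].
  by exists (enum_rank e); rewrite ?enum_rankK // inE enum_rankK.
have := card_uniq_tuples d A; rewrite cA ffactnn => <-; apply: eq_card => t.
rewrite !inE; apply/eqP/andP => [eT|[tA ut]].
  split; last by apply: uniq_tuple_edges; rewrite eT.
  by apply/allP => i it; rewrite inE -eT inE map_f.
apply/eqP; rewrite eqEcard cT cardsE; apply/andP; split.
  apply/fintype.subsetP => e; rewrite inE => /mapP[i it ->].
  by have /allP/(_ _ it) := tA.
by rewrite (card_uniqP _) ?size_map ?size_tuple // map_inj_uniq //; apply: enum_val_inj.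
Qed.

Lemma seq_det_tree (t : d.-tuple 'I_m) : spanning_tree G (tuple_edges t) ->
  seq_det K t = tree_mass G (tuple_edges t) * forest_const.
Proof.
move=> /spanning_treeE[sT cT dT]; rewrite transfer_minor det_incidence_connected //.
rewrite mulr1; congr (_ * _).
have us : uniq (map_tuple ei t) by rewrite map_inj_uniq ?uniq_tuple_edges //; apply: enum_val_inj.
rewrite big_uniq //= /tree_mass; apply: eq_big => [e|e es]; first by rewrite inE.
by rewrite /ext_weight (fintype.subsetP sT) // inE.
Qed.

Lemma seq_det_nontree (t : d.-tuple 'I_m) : ~ spanning_tree G (tuple_edges t) ->
  seq_det K t = 0.
Proof.
move=> nT; rewrite transfer_minor.
have [sT|/fintype.subsetPn[e]] := boolP (tuple_edges t \subset edges G); last first.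
  rewrite inE => es eG; suff -> : \prod_(e <- map_tuple ei t) ext_weight e = 0 by rewrite !mul0r.
  by rewrite (big_rem e) //= /ext_weight (negbTE eG) mul0r.
rewrite det_incidence_disconnected ?expr0n ?mulr0 ?mul0r // => cT.
apply: nT; apply/spanning_treeE; split=> //.
(* Connectivity needs at least [d] edges, and [t] lists at most [d]. *)
apply/eqP; rewrite eqn_leq connected_card // andbT cardsE.
by rewrite (leq_trans (card_size _)) // size_tuple.
Qed.

Lemma sum_trees (H : pred {set edge d.+1}) :
  \sum_(t : d.-tuple 'I_m | H (tuple_edges t)) seq_det K t =
  d`!%:R * forest_const * \sum_(T | `[< spanning_tree G T >] && H T) tree_mass G T.
Proof.
rewrite (partition_big tuple_edges H) //= mulr_sumr.
rewrite [RHS]big_mkcond [LHS]big_mkcond /=; apply: eq_bigr => T _.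
case HT : (H T); rewrite ?andbF ?andbT //.
case: asboolP => tT; last first.
  by rewrite big1 // => t /andP[_ /eqP eT]; apply: seq_det_nontree; rewrite eT.
rewrite (eq_bigr (fun=> tree_mass G T * forest_const)); last first.
  by move=> t /andP[_ /eqP eT]; have := tT; rewrite -eT; apply: seq_det_tree.
rewrite sumr_const (eq_card (B := [pred t : d.-tuple 'I_m | tuple_edges t == T])); last first.
  by move=> t; rewrite [LHS]inE [RHS]inE /=; case: eqP => [->|]; rewrite ?andbF ?HT.
have /spanning_treeE[_ _ cT] := tT.
rewrite card_tuple_edges // -mulr_natl; ring.
Qed.

(** The sum over all tuples is evaluated twice, by [sum_trees] and by [sum_seq_det]. In particular
    the total tree mass is nonzero. *)
Lemma forest_const_sum :
  forest_const * \sum_(T | `[< spanning_tree G T >]) tree_mass G T = 1.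
Proof.
have := sum_trees predT; rewrite (sum_seq_det transfer_orthoproj transfer_tr).
under [in RHS]eq_bigl do rewrite andbT.
move/esym; rewrite -mulrA -[RHS]mulr1; apply: mulfI.
by rewrite pnatr_eq0 -lt0n fact_gt0.
Qed.

Lemma tree_prE (P : {set edge d.+1} -> Prop) :
  d`!%:R * tree_pr G P =
  \sum_(t : d.-tuple 'I_m | `[< spanning_tree G (tuple_edges t) /\ P (tuple_edges t) >])
     seq_det K t.
Proof.
rewrite (sum_trees (fun T => `[< spanning_tree G T /\ P T >])) /tree_pr.
have Z := forest_const_sum; set Z0 := \sum_(T | _) _ in Z *.
have Z0n : Z0 != 0 by apply: contra_eq_neq Z => ->; rewrite mulr0 eq_sym oner_neq0.
rewrite -mulrA; congr (_ * _).
have -> : forest_const = Z0^-1 by rewrite -[LHS]mulr1 -(mulfV Z0n) mulrA Z mul1r.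
rewrite mulrC; congr (_ * _); apply: eq_bigl => T.
by apply/asboolP/andP => [[h1 h2]|[_ /asboolP]//]; split; apply/asboolP.
Qed.

Lemma tree_pr_compl (P : {set edge d.+1} -> Prop) :
  tree_pr G P = 1 - tree_pr G (fun T => ~ P T).
Proof.
have Z := forest_const_sum; rewrite /tree_pr.
set Z0 := \sum_(T | `[< spanning_tree G T >]) _ in Z *.
have Z0n : Z0 != 0 by apply: contra_eq_neq Z => ->; rewrite mulr0 eq_sym oner_neq0.
apply/eqP; rewrite eq_sym subr_eq -mulrDl; apply/eqP; rewrite -[LHS](mulfV Z0n); congr (_ / _).
rewrite /Z0 (bigID (fun T => `[< P T >])) /=; congr (_ + _); apply: eq_bigl => T.
  by rewrite asbool_and.
by rewrite asbool_and asbool_neg.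
Qed.

Lemma weight_leverage i : ei i \in edges G ->
  ext_weight (ei i) / K i i = weight G (ei i) / leverage G (ei i).
Proof. by move=> iG; rewrite transfer_diag /leverage /ext_weight iG. Qed.

Lemma tree_laplacian_frame (t : d.-tuple 'I_m) (x : 'cV[R]_d.+1) :
  spanning_tree G (tuple_edges t) ->
  bform (tree_laplacian G (tuple_edges t)) x x = bform (frame K t) (B *m x) (B *m x).
Proof.
move=> /spanning_treeE[sT _ cT]; rewrite tree_laplacian_form frame_form.
have us : uniq (map ei t) by rewrite map_inj_uniq ?uniq_tuple_edges //; apply: enum_val_inj.
transitivity (\sum_(e <- map ei t) weight G e / leverage G e * ((bvec R e)^T *m x) 0 0 ^+ 2).
  by rewrite big_uniq //=; apply: eq_bigl => e; rewrite inE.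
rewrite big_map big_seq [RHS]big_seq; apply: eq_bigr => i it.
by rewrite weight_leverage // (fintype.subsetP sT) // inE map_f.
Qed.

Lemma laplacian_form (x : 'cV[R]_d.+1) : bform L x x = bform 1%:M (B *m x) (B *m x).
Proof. by rewrite laplacianE /bform mulmx1 trmx_mul !mulmxA. Qed.

Lemma tree_laplacian_sym T : (tree_laplacian G T)^T = tree_laplacian G T.
Proof.
rewrite /tree_laplacian /laplacian linear_sum; apply: eq_bigr => e _.
by rewrite linearZ /= trmx_mul trmxK.
Qed.

(** One power of [d.+1] is the growth of the potential relative to the total weight; the other two
    count the vertex pairs indexing [K]. *)
Lemma tree_pr_tail (a q : R) p : 0 < q -> q <= a -> (1 + q^-1) ^+ p <= 2 ->
  tree_pr G (fun T => ~ loewner_le (tree_laplacian G T) (a *: L)) * 2 ^+ p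
    <= d.+1%:R ^+ 3.
Proof.
move=> q_gt0 qa hq; rewrite -(ler_pM2l (_ : 0 < d`!%:R)); last by rewrite ltr0n fact_gt0.
rewrite mulrA tree_prE.
apply: le_trans (sum_seq_det_tail transfer_orthoproj transfer_tr q_gt0 hq _) _; last first.
  by rewrite card_prod card_ord factS !natrM; rewrite le_eqVlt; apply/orP; left; apply/eqP; ring.
move=> t /asboolP[tT nle].
(* Both matrices are symmetric, so the order can fail only at some vector [x]; its image [B *m x] is
   the bad vector for the frame. *)
have [x xP] : exists x, ~ 0 <= bform (a *: L - tree_laplacian G (tuple_edges t)) x x.
  apply/existsNP => h; apply: nle; split=> //.
  by rewrite linearB linearZ /= laplacian_sym tree_laplacian_sym.
exists (B *m x); rewrite -tree_laplacian_frame // -laplacian_form.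
move/negP: xP; rewrite -ltNge bformDm bformZm -scaleN1r bformZm mulN1r subr_lt0.
apply: le_lt_trans; rewrite ler_wpM2r // laplacian_form; exact: bform1_ge0.
Qed.

End Graph.

(** * Choice of the constants *)

Lemma inv_bernoulli (R : realFieldType) p : (0 < p)%N ->
  (1 + (2 * p%:R)^-1) ^+ p <= 2 :> R.
Proof.
move=> p_gt0; set a : R := _^-1.
have a0 : 0 <= a by rewrite invr_ge0 mulr_ge0 ?ler0n.
have pa : p%:R * a = 2^-1.
  by rewrite /a invfM mulrCA mulfV ?mulr1 // pnatr_eq0 -lt0n.
(* At [k = p] the second factor is one half. The induction rests on (1 + a)(1 - (k + 1)a) <= 1 -
   ka. *)
have h k : (1 + a) ^+ k * (1 - k%:R * a) <= 1.
  elim: k => [|k IH]; first by rewrite mul0r subr0 mul1r.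
  apply: le_trans IH; rewrite exprSr -mulrA ler_wpM2l ?exprn_ge0 ?addr_ge0 //.
  rewrite -natr1; have := ler0n R k; nra.
have := h p; rewrite pa; lra.
Qed.

Lemma tree_pr_ge0 (R : realType) n (G : wgraph R n) (P : {set edge n} -> Prop) :
  0 <= tree_pr G P.
Proof.
have mass_ge0 T : spanning_tree G T -> 0 <= tree_mass G T.
  by case=> sT _ _; apply: prodr_ge0 => e /(fintype.subsetP sT)/weight_gt0/ltW.
apply: divr_ge0; apply: sumr_ge0 => T /asboolP; last exact: mass_ge0.
by case=> tT _; apply: mass_ge0.
Qed.

Theorem theorem1p5 (R : realType) (c : R) (hc : 0 < c) :
  exists2 C : R, 0 < C &
    forall (n : nat) (G : wgraph R n), connected_graph G ->
      1 - n%:R `^ (- c) <=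
      tree_pr G (fun T =>
        loewner_le (tree_laplacian G T) ((C * ln n%:R) *: graph_laplacian G)).
Proof.
have ln2 : 0 < ln 2%:R :> R by rewrite ln_gt0 // ltr1n.
(* With [y] the binary logarithm of [n], the exponent [p] is at most [(c + 3) * y + 1], hence at
   most [(c + 4) * y] once [y >= 1]; the constant then covers [q = 2 * p]. *)
exists (2 * (c + 4) / ln 2%:R); first by rewrite divr_gt0 // mulr_gt0 // addr_gt0.
case=> [|d] G G_conn; first by case: G_conn; rewrite ltnn.
(* For a single vertex the lower bound is 0; otherwise [y >= 1] absorbs the rounding of [p]. *)
have [d0|d0] := eqVneq d 0%N.
  by rewrite {1}d0 powR1 subrr tree_pr_ge0.
set a := _ * ln _; pose n : R := d.+1%:R.
have n0 : 0 < n by rewrite ltr0n.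
pose y := ln n / ln 2%:R.
have y1 : 1 <= y.
  by rewrite ler_pdivlMr // mul1r ler_ln ?posrE ?ltr0n // ler_nat ltnS lt0n.
pose x := (c + 3) * y.
have x0 : 0 <= x by rewrite /x; nra.
pose p := (Num.truncn x).+1.
have xp : x <= p%:R by apply/ltW/truncnS_gt.
have px : p%:R <= x + 1.
  by rewrite -natr1 lerD2r; have /andP[] := truncn_itv x0.
have aE : a = 2 * (c + 4) * y by rewrite /a /y -/n; ring.
have qa : 2 * p%:R <= a by rewrite aE; rewrite /x in px; nra.
rewrite tree_pr_compl // lerD2l lerN2.
have := @tree_pr_tail _ _ _ G_conn a (2 * p%:R) p.
rewrite mulr_gt0 ?ltr0n // inv_bernoulli // => /(_ isT qa isT).
set prob := tree_pr _ _ => tail.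
(* The 3 in the exponent cancels the cubic factor of [tail], and [c] remains for the failure
   probability. *)
have n2p : n `^ (c + 3) <= 2 ^+ p.
  rewrite -ler_ln ?posrE ?powR_gt0 ?exprn_gt0 //.
  by rewrite ln_powR lnXn // -[_ *+ p]mulr_natl -ler_pdivrMr // -mulrA.
have := le_trans (ler_wpM2l (tree_pr_ge0 G _) n2p) tail.
rewrite powRD; last by apply/implyP => _; rewrite gt_eqF.
rewrite -/n mulrA (powR_mulrn 3 (ltW n0)) ger_pMl ?exprn_gt0 //.
by rewrite powRN -div1r ler_pdivlMr // powR_gt0.
Qed.
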